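(* As $d\to\infty$, the sphere packing density $\theta(d)$ of $\mathbb{R}^d$ satisfies $$\theta(d)\ \ge\ (1+o_d(1))\,\frac{\log(2/\sqrt{3})\cdot d}{2^d},$$ i.e. there is a sequence $(\varepsilon_d)_{d\ge 1}$ with $\varepsilon_d\to 0$ as $d\to\infty$ such that $\theta(d)\ge (1+\varepsilon_d)\log(2/\sqrt3)\, d\, 2^{-d}$ for all $d\ge 1$.
   Context: $\log$ is the natural logarithm. The sphere packing density of $\mathbb{R}^d$ is $$\theta(d)=\sup_{\mathcal{P}}\ \limsup_{R\to\infty}\frac{\mathrm{vol}(\mathcal{P}\cap B_R(0))}{\mathrm{vol}(B_R(0))},$$ where the supremum is over all packings $\mathcal{P}$ of $\mathbb{R}^d$ by equal-sized (non-overlapping) spheres, $B_R(x)$ is the closed ball of radius $R$ around $x$, and $\mathrm{vol}(\mathcal{P}\cap B_R(0))$ is the volume of the part of $B_R(0)$ covered by the spheres (solid balls) of the packing. *)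

(* Defs.v *)
From HB Require Import structures.
From mathcomp Require Import all_boot all_order all_algebra.
From mathcomp Require Import all_classical all_reals all_analysis.
Import Order.TTheory GRing.Theory Num.Theory.
Import numFieldNormedType.Exports.

Set Implicit Arguments.
Unset Strict Implicit.
Unset Printing Implicit Defensive.

Local Open Scope classical_set_scope.
Local Open Scope ring_scope.

Definition cons_pair (T : Type) n (p : T * n.-tuple T) : n.+1.-tuple T :=
  [tuple of p.1 :: p.2].

Section lebesgue_tuple_step.
Context {R : realType} (n : nat).
Variable mu : {sigma_finite_measure set (n.-tuple (measurableTypeR R)) -> \bar R}.

Let T := measurableTypeR R.

Let mcons : measurable_fun [set: T * n.-tuple T] (@cons_pair T n).
Proof. exact: (measurable_cons measurable_fst measurable_snd). Qed.

Definition lebesgue_tuple_step : set (n.+1.-tuple T) -> \bar R :=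
  pushforward (lebesgue_measure \x mu)%E (@cons_pair T n).

Let step0 : lebesgue_tuple_step set0 = 0%E.
Proof. by rewrite /lebesgue_tuple_step /pushforward preimage_set0 measure0. Qed.

Let step_ge0 A : (0 <= lebesgue_tuple_step A)%E.
Proof. exact: measure_ge0. Qed.

Let step_sigma_additive : semi_sigma_additive lebesgue_tuple_step.
Proof.
move=> F mF tF mUF; rewrite /lebesgue_tuple_step /pushforward preimage_bigcup.
apply: measure_semi_sigma_additive.
- by move=> i; rewrite -[X in measurable X]setTI; exact: mcons.
- apply/trivIsetP => /= i j _ _ ij; rewrite -preimage_setI.
  by move/trivIsetP : tF => /(_ _ _ _ _ ij) ->//; rewrite preimage_set0.
- by rewrite -preimage_bigcup -[X in measurable X]setTI; exact: mcons.
Qed.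

HB.instance Definition _ := isMeasure.Build _ _ _
  lebesgue_tuple_step step0 step_ge0 step_sigma_additive.

Let step_sigma_finite : sigma_finite setT lebesgue_tuple_step.
Proof.
have /sigma_finiteP[F [FT ndF mF]] := sigma_finiteT (@lebesgue_measure R).
have /sigma_finiteP[G [GT ndG mG]] := sigma_finiteT mu.
pose g (t : n.+1.-tuple T) : T * n.-tuple T := (thead t, [tuple of behead t]).
have mg : measurable_fun setT g.
  apply: measurable_fun_pair; first exact: measurable_tnth.
  exact: measurable_behead.
exists (fun k => g @^-1` (F k `*` G k)).
  apply/seteqP; split => // t _.
  have [i _ Fi] : (\bigcup_i F i) (g t).1 by rewrite -FT.
  have [j _ Gj] : (\bigcup_i G i) (g t).2 by rewrite -GT.
  exists (maxn i j) => //; split.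
  - by move: Fi; exact/subsetPset/ndF/leq_maxl.
  - by move: Gj; exact/subsetPset/ndG/leq_maxr.
move=> k; have [mFk Fk] := mF k; have [mGk Gk] := mG k; split.
  by rewrite -[X in measurable X]setTI; apply: mg => //; exact: measurableX.
rewrite /lebesgue_tuple_step /pushforward -comp_preimage.
rewrite (_ : g \o _ = id) ?preimage_id; last first.
  by apply/funext => -[x t]; rewrite /g /=; congr pair; apply/val_inj.
by rewrite product_measure1E// lte_mul_pinfty// ge0_fin_numE.
Qed.

HB.instance Definition _ := Measure_isSigmaFinite.Build _ _ _
  lebesgue_tuple_step step_sigma_finite.

End lebesgue_tuple_step.

Section lebesgue_tuple.
Context {R : realType}.
Local Notation T := (measurableTypeR R).

(* Lebesgue measure on the product sigma-algebra of [n.-tuple R]; see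
   [lebesgue_tuple_box] for the characterization on boxes. *)
Fixpoint lebesgue_tuple n : set (n.-tuple T) -> \bar R :=
  match n with
  | 0 => \d_([tuple] : 0.-tuple T)
  | m.+1 => pushforward (lebesgue_measure \x @lebesgue_tuple m)%E
                        (@cons_pair T m)
  end.

Let lebesgue_tuple_measure n :
  exists mu : {sigma_finite_measure set (n.-tuple T) -> \bar R},
    @lebesgue_tuple n = mu.
Proof.
elim: n => [|n [mu IH]] /=; first by eexists.
by exists (@lebesgue_tuple_step R n mu); rewrite IH.
Qed.

Let lebesgue_tuple0 n : @lebesgue_tuple n set0 = 0%E.
Proof. by have [mu ->] := lebesgue_tuple_measure n; rewrite measure0. Qed.

Let lebesgue_tuple_ge0 n A : (0 <= @lebesgue_tuple n A)%E.
Proof. by have [mu ->] := lebesgue_tuple_measure n. Qed.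

Let lebesgue_tuple_sigma_additive n : semi_sigma_additive (@lebesgue_tuple n).
Proof.
have [mu ->] := lebesgue_tuple_measure n.
exact: measure_semi_sigma_additive.
Qed.

HB.instance Definition _ n := isMeasure.Build _ _ _ (@lebesgue_tuple n)
  (lebesgue_tuple0 n) (@lebesgue_tuple_ge0 n) (@lebesgue_tuple_sigma_additive n).

Let lebesgue_tuple_sigma_finite n : sigma_finite setT (@lebesgue_tuple n).
Proof. by have [mu ->] := lebesgue_tuple_measure n; exact: sigma_finiteT. Qed.

HB.instance Definition _ n := Measure_isSigmaFinite.Build _ _ _
  (@lebesgue_tuple n) (lebesgue_tuple_sigma_finite n).

Lemma lebesgue_tuple_box n (A : 'I_n -> set T) :
  (forall i, measurable (A i)) ->
  lebesgue_tuple [set t : n.-tuple T | forall i, A i (tnth t i)] =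
  (\prod_(i < n) lebesgue_measure (A i))%E.
Proof.
elim: n A => [|n IH] A mA.
  by rewrite big_ord0 /= diracE mem_set//= => -[].
rewrite big_ord_recl -IH // /= /pushforward -product_measure1E //.
  congr (_ _); apply/seteqP; split => -[x t] /=.
    move=> h; split; first by have := h ord0; rewrite tnth0.
    by move=> i; have := h (lift ord0 i); rewrite tnthS.
  move=> [h0 h] i; have [j ->|->] := unliftP ord0 i; first by rewrite tnthS.
  by rewrite tnth0.
rewrite (_ : mkset _ = \bigcap_(i in [set: 'I_n])
  ((fun t : n.-tuple T => tnth t i) @^-1` A (lift ord0 i))).
  apply: fin_bigcap_measurable => // i _.
  rewrite -[X in measurable X]setTI; exact: measurable_tnth.
by apply/seteqP; split => t /= h i => [_|]; exact: h.
Qed.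

End lebesgue_tuple.

Section sphere_packing.
Context {R : realType} {d : nat}.
Implicit Types (x y : 'rV[R]_d) (A C : set 'rV[R]_d) (r : R).

Definition vol A : \bar R :=
  lebesgue_tuple
    [set t : d.-tuple (measurableTypeR R) | A (\row_(i < d) tnth t i)].

(* The norm that MathComp puts on ['rV[R]_d] is the sup norm. *)
Definition enorm x : R := Num.sqrt (\sum_(i < d) x ord0 i ^+ 2).

Definition closed_eball x r : set 'rV[R]_d := [set y | enorm (y - x) <= r].

Definition open_eball x r : set 'rV[R]_d := [set y | enorm (y - x) < r].

(* [C] is the set of centres and [r] the common radius; the balls may touch. *)
Definition sphere_packing C r : Prop :=
  0 < r /\ trivIset C (fun x => open_eball x r).

Definition covered C r : set 'rV[R]_d := \bigcup_(x in C) closed_eball x r.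

Definition upper_density A : \bar R :=
  limf_esup (fun rho : R =>
    vol (A `&` closed_eball 0 rho) / vol (closed_eball 0 rho))%E +oo.

End sphere_packing.

Definition packing_density (R : realType) (d : nat) : \bar R :=
  ereal_sup [set s | exists (C : set 'rV[R]_d) (r : R),
    sphere_packing C r /\ s = upper_density (covered C r)].

(* Main.v *)
(** Hard-core model on a fine grid, a discrete form of the hard-sphere argument
    of Jenssen, Joos and Perkins. Put the weight [lam ^ #|I|] on the sets [I] of
    grid points in a large cube that are pairwise at distance more than [2 r].
    Given [I] outside the ball of radius [2 r] about a point [v], the rest of [I]
    is a hard-core set on the set [T] of points of that ball which are not
    blocked from outside. Hence [v] is occupied with probability
    [lam / Z(T) >= lam * exp (- lam * #|T|)], and since a subset [T] of a ball of
    radius [2 r] has average degree at most about [2 * vol (B (sqrt 3 * r))], for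
    [lam] slightly smaller than the inverse of that number about [lam * #|T|]
    points of the ball are occupied. Averaging over [v], the occupancy [a] of a
    point satisfies, for [Delta] about [vol (B (2 r))] and every [Y], either
    [a * Delta >= (1 - o(1)) Y] or [a >= lam * exp (- Y)]. As [lam * Delta] is
    about [(2 / sqrt 3) ^ d], taking [Y] close to [d * ln (2 / sqrt 3)] gives
    [a * Delta >= (1 - o(1)) * d * ln (2 / sqrt 3)], and balls of radius [r]
    have volume [2 ^ (- d) * Delta]. Repeating the cube periodically
    turns this finite packing into a packing of the whole space. *)

Require Import Defs.
From mathcomp Require Import all_boot all_order all_algebra.
From mathcomp Require Import all_classical all_reals all_analysis.
From mathcomp Require Import measurable_realfun ring lra.
Import Order.TTheory GRing.Theory Num.Theory.
Import numFieldNormedType.Exports.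

Set Implicit Arguments.
Unset Strict Implicit.
Unset Printing Implicit Defensive.

Local Open Scope ring_scope.

(** * The hard-core model on a finite graph *)

Section hard_core.
Context {R : realType} {V : finType} (c : rel V).
Context (c_refl : reflexive c) (c_sym : symmetric c).
Implicit Types (I J K S T N : {set V}) (u v : V).

Definition pairwise_far I :=
  [forall u in I, forall v in I, c u v ==> (u == v)].

(** The closed neighbourhood: reflexivity of [c] puts [v] itself in it. *)
Definition nbhd v : {set V} := [set u | c v u].

(** The independence polynomial, at [lam], of the graph that [c] induces on [S], loops
    disregarded. *)
Definition partition_fun (lam : R) S : R :=
  \sum_(I : {set V} | pairwise_far I && (I \subset S)) lam ^+ #|I|.

Definition unblocked S J : {set V} :=
  [set x in S | [forall y in J, ~~ c x y]].

Lemma pairwise_farP I :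
  reflect (forall u v, u \in I -> v \in I -> c u v -> u = v) (pairwise_far I).
Proof.
apply: (iffP idP) => [/forall_inP h u v uI vI cuv|h].
  by move: (h u uI) => /forall_inP/(_ v vI)/implyP/(_ cuv)/eqP.
apply/forall_inP => u uI; apply/forall_inP => v vI.
by apply/implyP => /(h u v uI vI) ->.
Qed.

(** Spatial Markov property. A far set is determined by its parts [J] outside and [K] inside [N],
    and two such parts recombine to a far set exactly when [K] avoids all points close to [J]. A
    general [F] covers weights together with observables. *)
Lemma sum_pairwise_far_split S N (F : {set V} -> {set V} -> R) :
  \sum_(I | pairwise_far I && (I \subset S)) F (I :\: N) (I :&: N) =
  \sum_(J | pairwise_far J && (J \subset S :\: N))
    \sum_(K | pairwise_far K && (K \subset unblocked (S :&: N) J)) F J K.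
Proof.
rewrite pair_big_dep /=.
rewrite (reindex_onto (fun I => (I :\: N, I :&: N)) (fun p => p.1 :|: p.2)) /=.
  apply: eq_bigl => I.
  rewrite [I :\: N :|: I :&: N]finset.setUC finset.setID eqxx andbT.
  apply/idP/idP.
    move=> /andP[/pairwise_farP sI IS]; rewrite -!andbA; apply/and4P; split.
    - by apply/pairwise_farP => u v /finset.setDP[uI _] /finset.setDP[vI _];
      exact: sI.
    - exact: finset.setSD.
    - by apply/pairwise_farP => u v /finset.setIP[uI _] /finset.setIP[vI _];
      exact: sI.
    - apply/fintype.subsetP => u /finset.setIP[uI uN];
      rewrite !inE uN (fintype.subsetP IS)//=.
      apply/forall_inP => v /finset.setDP[vI vN]; apply/negP => cuv.
      by move: vN; rewrite -(sI _ _ uI vI cuv) uN.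
  move=> /andP[/andP[/pairwise_farP sJ JS]] /andP[/pairwise_farP sK KS].
  (* Points of [I] in [N] are not blocked by those outside, so no pair across the boundary of [N] is
     close. *)
  have key u v : u \in I -> v \in I -> u \in N -> v \notin N -> ~~ c u v.
    move=> uI vI uN vN.
    have /(fintype.subsetP KS) : u \in I :&: N by rewrite inE uI.
    rewrite inE => /andP[_ /forall_inP]; apply.
    by rewrite inE vN.
  apply/andP; split.
    apply/pairwise_farP => u v uI vI cuv.
    case: (boolP (u \in N)) (boolP (v \in N)) => uN [] vN.
    + by apply: sK => //; rewrite inE ?uI ?vI.
    + by move: (key _ _ uI vI uN vN); rewrite cuv.
    + by move: (key _ _ vI uI vN uN); rewrite c_sym cuv.
    + by apply: sJ => //; rewrite inE ?uI ?vI ?uN ?vN.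
  apply/fintype.subsetP => u uI; case: (boolP (u \in N)) => uN.
    have /(fintype.subsetP KS) : u \in I :&: N by rewrite inE uI.
    by rewrite !inE => /andP[/andP[]].
  have /(fintype.subsetP JS) : u \in I :\: N by rewrite inE uI uN.
  by rewrite !inE => /andP[].
move=> [J K] /= /andP[/andP[_ JS] /andP[_ KS]].
have JN u : u \in J -> u \notin N.
  by move=> /(fintype.subsetP JS); rewrite inE => /andP[].
have KN u : u \in K -> u \in N.
  by move=> /(fintype.subsetP KS); rewrite !inE => /andP[/andP[]].
congr pair; apply/setP => u; rewrite !inE.
  case: (boolP (u \in J)) => [/JN ->//|_ /=].
  by case: (boolP (u \in K)) => [/KN -> //|]; rewrite andbF.
case: (boolP (u \in K)) => [/KN ->|_ /=]; first by rewrite orbT.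
by rewrite orbF; case: (boolP (u \in J)) => // /JN/negbTE ->.
Qed.

Lemma cardsDI I N : #|I| = (#|I :\: N| + #|I :&: N|)%N.
Proof. by rewrite addnC cardsID. Qed.

Lemma pairwise_far0 : pairwise_far finset.set0.
Proof. by apply/pairwise_farP => u v; rewrite inE. Qed.

Lemma pairwise_far1 u : pairwise_far [set u].
Proof. by apply/pairwise_farP => v w; rewrite !inE => /eqP -> /eqP ->. Qed.

Section fugacity.
Context (lam : R) (lam_gt0 : 0 < lam).
Local Notation Z := (partition_fun lam).

Let weight_ge0 I : 0 <= lam ^+ #|I|.
Proof. by rewrite exprn_ge0// ltW. Qed.

Lemma partition_fun_ge0 S : 0 <= Z S.
Proof. exact: sumr_ge0. Qed.

Lemma partition_fun_gt0 S : 0 < Z S.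
Proof.
rewrite /partition_fun (bigD1 finset.set0) ?pairwise_far0 ?finset.sub0set//=.
by rewrite cards0 expr0 ltr_wpDr// sumr_ge0.
Qed.

(** Dropping the distance condition leaves all subsets of [S], whose weights sum to
    [(1 + lam) ^+ #|S|]. *)
Lemma partition_fun_le_expR S : Z S <= expR (lam * #|S|%:R).
Proof.
have -> : expR (lam * #|S|%:R) = expR lam ^+ #|S|.
  by rewrite -expRM_natr.
apply: (@le_trans _ _ ((1 + lam) ^+ #|S|)); last first.
  by apply: lerXn2r; rewrite ?nnegrE ?expR_ge0 ?expR_ge1Dx// addr_ge0// ltW.
rewrite -(prodr_const (mem S)) big_mkcond/=.
have -> : \prod_(i : V) (if i \in S then 1 + lam else 1) =
   \prod_(i : V) ((if i \in S then lam else 0) + 1).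
  by apply: eq_bigr => i _; case: ifP => _; rewrite addrC// addr0.
rewrite bigA_distr /= /partition_fun big_mkcond/= ler_sum// => I _.
case: ifP => [/andP[_ IS]|_].
  rewrite (bigID (mem I))/= [X in _ * X]big1 ?mulr1;
    last by move=> i /negbTE ->.
  rewrite (eq_bigr (fun=> lam)) ?prodr_const// => i iI.
  by rewrite iI (fintype.subsetP IS).
apply: prodr_ge0 => i _; case: ifP => // _; case: ifP => // _; exact: ltW.
Qed.

Lemma partition_fun_mono S T : S \subset T -> Z S <= Z T.
Proof.
move=> ST; rewrite /partition_fun [leRHS](bigID (fun I => I \subset S))/=.
rewrite [X in _ <= X + _](eq_bigl (fun I => pairwise_far I && (I \subset S))).
  by rewrite lerDl sumr_ge0.
move=> I; rewrite -andbA; congr andb; apply: andb_idl => IS.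
exact: fintype.subset_trans ST.
Qed.

(** After the split at [N], the inner part may range over all far subsets of [S :&: N] once blocking
    is ignored. *)
Lemma partition_fun_submul S N : Z S <= Z (S :\: N) * Z (S :&: N).
Proof.
rewrite /partition_fun.
rewrite (eq_bigr (fun I => lam ^+ #|I :\: N| * lam ^+ #|I :&: N|)); last first.
  by move=> I _; rewrite -exprD -cardsDI.
rewrite (sum_pairwise_far_split S N (fun J K => lam ^+ #|J| * lam ^+ #|K|)).
rewrite mulr_suml ler_sum// => J _; rewrite -mulr_sumr ler_wpM2l//.
apply: partition_fun_mono; apply/fintype.subsetP => x.
by rewrite inE => /andP[].
Qed.

(** Divided by [Z S], this gives the probability that [u] is occupied. An occupied [u] empties the
    rest of its neighbourhood, so it contributes a factor [lam] and leaves an arbitrary far subset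
    of [S :\: nbhd u]. *)
Lemma sum_pairwise_far_mem S u : u \in S ->
  \sum_(I | pairwise_far I && (I \subset S)) lam ^+ #|I| * (u \in I)%:R =
  lam * Z (S :\: nbhd u).
Proof.
move=> uS.
rewrite (eq_bigr (fun I => lam ^+ #|I :\: nbhd u| *
  (lam ^+ #|I :&: nbhd u| * (u \in I :&: nbhd u)%:R))); last first.
  by move=> I _; rewrite mulrA -exprD -cardsDI !inE c_refl andbT.
rewrite (sum_pairwise_far_split S (nbhd u)
  (fun J K => lam ^+ #|J| * (lam ^+ #|K| * (u \in K)%:R))).
rewrite /partition_fun mulr_sumr; apply: eq_bigr => J /andP[_ JS].
rewrite -mulr_sumr mulrC; congr (_ * _).
rewrite (bigD1 [set u])/=; last first.
  rewrite pairwise_far1 finset.sub1set !inE uS c_refl /=.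
  apply/forall_inP => y /(fintype.subsetP JS).
  by rewrite !inE => /andP[].
rewrite cards1 expr1 set11 mulr1 big1 ?addr0// => K /andP[/andP[/pairwise_farP
  sK KS] Ku].
rewrite (_ : u \in K = false) ?mulr0//; apply/negP => uK.
move/eqP: Ku; apply; apply/setP => x; rewrite inE; apply/idP/eqP => [xK|->//].
apply/esym/sK => //.
by move/(fintype.subsetP KS): xK; rewrite !inE => /andP[/andP[]].
Qed.

(** Each [u] in [T] is occupied with probability [lam * Z (T :\: nbhd u) / Z T]. By
    submultiplicativity and the exponential bound this is at least
    [lam * (1 - lam * #|T :&: nbhd u|)]; summing over [u] brings in the degree bound. *)
Lemma mean_card_ge (D : R) T :
  \sum_(u in T) #|T :&: nbhd u|%:R <= D * #|T|%:R ->
  lam * (1 - lam * D) * #|T|%:R * Z T <=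
  \sum_(I | pairwise_far I && (I \subset T)) lam ^+ #|I| * #|I|%:R.
Proof.
move=> TD.
have -> : \sum_(I | pairwise_far I && (I \subset T)) lam ^+ #|I| * #|I|%:R =
  \sum_(u in T) lam * Z (T :\: nbhd u).
  rewrite (eq_bigr (fun I => \sum_(u in T) lam ^+ #|I| * (u \in I)%:R)).
    by rewrite exchange_big/=; apply: eq_bigr => u; exact: sum_pairwise_far_mem.
  move=> I /andP[_ IT]; rewrite -mulr_sumr; congr (_ * _).
  rewrite -sum1_card natr_sum big_mkcond [RHS]big_mkcond/=.
  apply: eq_bigr => u _;
    case: (boolP (u \in I)) => [/(fintype.subsetP IT) ->//|_].
  by case: ifP.
have key u : lam * Z T * (1 - lam * #|T :&: nbhd u|%:R) <= lam * Z (T :\: nbhd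
  u).
  rewrite -mulrA ler_wpM2l ?(ltW lam_gt0)//.
  have Zb := partition_fun_le_expR (T :&: nbhd u).
  apply: (@le_trans _ _ (Z T * expR (- (lam * #|T :&: nbhd u|%:R)))).
    by rewrite ler_wpM2l ?partition_fun_ge0// (le_trans _ (expR_ge1Dx _)).
  rewrite expRN ler_pdivrMr ?expR_gt0//.
  apply: le_trans (partition_fun_submul T (nbhd u)) _.
  by rewrite ler_wpM2l// partition_fun_ge0.
apply: le_trans (ler_sum _ (fun u _ => key u)).
rewrite -mulr_sumr sumrB sumr_const -mulr_sumr.
rewrite (_ : lam * _ * _ * _ = lam * Z T * (#|T|%:R - lam * (D * #|T|%:R)));
  last by ring.
rewrite ler_wpM2l ?mulr_ge0 ?partition_fun_ge0 ?(ltW lam_gt0)//.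
by rewrite lerB// ler_wpM2l// ltW.
Qed.

End fugacity.

(* The mean of [lam * #|unblocked (nbhd v) (I :\: nbhd v)|] over [v] and over the
   hard-core distribution of [I] bounds the occupancy of neighbourhoods from
   below; if this mean is less than [Y], the tangent line of [exp (- x)] at
   [x = Y] bounds the occupancy of single points from below instead. *)
Lemma hard_core_occupancy (lam D Delta Y : R) :
  0 < lam -> lam * D <= 1 ->
  (forall v, #|nbhd v|%:R <= Delta) ->
  (forall v T, T \subset nbhd v ->
    \sum_(u in T) #|T :&: nbhd u|%:R <= D * #|T|%:R) ->
  exists2 I, pairwise_far I &
    #|V|%:R * ((1 - lam * D) * Y) <= #|I|%:R * Delta \/
    #|V|%:R * (lam * expR (- Y)) <= #|I|%:R.
Proof.
move=> lam0 lamD HDelta HD.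
(* A largest far set is the witness: its size is at least the mean size under the hard-core
   distribution. *)
have [I0 sI0 maxI] : exists2 I, pairwise_far I &
    forall J, pairwise_far J -> (#|J| <= #|I|)%N.
  by case: (arg_maxnP (fun I => #|I|) pairwise_far0) => I sI h; exists I.
exists I0 => //.
pose w I : R := lam ^+ #|I|.
have w0 I : 0 <= w I by rewrite exprn_ge0// ltW.
pose T I v := unblocked (nbhd v) (I :\: nbhd v).
pose Z : R := \sum_(I | pairwise_far I) w I.
have ZE : Z = partition_fun lam [set: V].
  by apply: eq_bigl => I; rewrite finset.subsetT andbT.
have Z0 : 0 < Z by rewrite ZE partition_fun_gt0.
pose y : R := \sum_(v : V) \sum_(I | pairwise_far I) w I * (lam * #|T I v|%:R).
have cardE : \sum_(I | pairwise_far I) w I * #|I|%:R =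
   \sum_v \sum_(I | pairwise_far I) w I * (v \in I)%:R.
  rewrite exchange_big/=; apply: eq_bigr => I _; rewrite -mulr_sumr.
  by congr (_ * _); rewrite -sum1_card natr_sum big_mkcond/=;
    apply: eq_bigr => v _; case: ifP.
have cardle : \sum_(I | pairwise_far I) w I * #|I|%:R <= #|I0|%:R * Z.
  rewrite mulr_sumr ler_sum// => I sI; rewrite mulrC ler_wpM2r// ler_nat.
  exact: maxI.
have Delta0 (v : V) : 0 <= Delta by exact: le_trans (HDelta v).
have splitT v (F : {set V} -> {set V} -> R) :
    \sum_(I | pairwise_far I) F (I :\: nbhd v) (I :&: nbhd v) =
    \sum_(J | pairwise_far J && (J \subset [set: V] :\: nbhd v))
    \sum_(K | pairwise_far K && (K \subset unblocked (nbhd v) J)) F J K.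
  have := sum_pairwise_far_split [set: V] (nbhd v) F.
  rewrite finset.setTI => <-.
  by apply: eq_bigl => I; rewrite finset.subsetT andbT.
(* Given the part [J] outside [nbhd v], the part inside is a hard-core set on the unblocked points,
   to which [mean_card_ge] applies. Summed over [v], each point of [I] is counted once for each of
   its at most [Delta] neighbours. *)
have neighbours : (1 - lam * D) * y <= #|I0|%:R * Delta * Z.
  apply: (@le_trans _ _ (\sum_v \sum_(I | pairwise_far I)
    w I * #|I :&: nbhd v|%:R)).
    rewrite /y mulr_sumr ler_sum// => v _.
    rewrite (eq_bigr (fun I => w (I :\: nbhd v) * w (I :&: nbhd v) *
      (lam * #|unblocked (nbhd v) (I :\: nbhd v)|%:R))); last first.
      by move=> I _; rewrite /w -exprD -cardsDI.
    rewrite (splitT v (fun J K =>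
      w J * w K * (lam * #|unblocked (nbhd v) J|%:R))).
    rewrite [leRHS](eq_bigr (fun I => w (I :\: nbhd v) * w (I :&: nbhd v) *
      #|I :&: nbhd v|%:R)); last first.
      by move=> I _; rewrite /w -exprD -cardsDI.
    rewrite (splitT v (fun J K => w J * w K * #|K|%:R)).
    rewrite mulr_sumr ler_sum// => J _.
    have := @mean_card_ge lam lam0 D (unblocked (nbhd v) J).
    set U := unblocked _ _ => /(_ (HD v U _)).
    have /[swap]/[apply] : U \subset nbhd v.
      by apply/fintype.subsetP => x; rewrite inE => /andP[].
    move=> /(ler_wpM2l (w0 J)); rewrite /partition_fun -/(w _) => h.
    apply: le_trans (le_trans h _).
      rewrite -mulr_suml -mulr_sumr /w le_eqVlt; apply/orP; left; apply/eqP;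
        ring.
    by rewrite mulr_sumr; apply: ler_sum => K _; rewrite mulrA.
  rewrite exchange_big/=.
  apply: (@le_trans _ _ (\sum_(I | pairwise_far I) w I * #|I|%:R * Delta)).
    apply: ler_sum => I _; rewrite -mulr_sumr -mulrA ler_wpM2l//.
    rewrite -natr_sum.
    have -> : (\sum_(v : V) #|I :&: nbhd v| = \sum_(u in I) #|nbhd u|)%N.
      under eq_bigr do rewrite -sum1_card big_mkcond/=.
      rewrite exchange_big/= [RHS]big_mkcond/=; apply: eq_bigr => u _.
      case: (boolP (u \in I)) => uI; last first.
        by rewrite big1// => v _; rewrite !inE (negbTE uI).
      rewrite -sum1_card [RHS]big_mkcond/=; apply: eq_bigr => v _.
      by rewrite !inE uI c_sym.
    rewrite natr_sum mulrC mulr_natr -sumr_const ler_sum// => u _.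
  rewrite -mulr_suml mulrAC.
  (* If [V] is empty, the sign of [Delta] is unknown, but all cardinalities vanish. *)
  case: (pickP (mem V)) => [v _|V0]; first by rewrite ler_wpM2r ?(Delta0 v).
  have E I : #|I| = 0%N by rewrite -(card0 V); apply: eq_card => x;
    have := V0 x.
  rewrite big1 ?mul0r ?E ?mul0r//.
  by move=> I _; rewrite E mulr0.
(* Given [J], occupying [v] has weight [lam] against the partition function of the unblocked set,
   which is bounded by an exponential. *)
have centre : \sum_v \sum_(I | pairwise_far I)
    w I * (lam * expR (- (lam * #|T I v|%:R))) <= #|I0|%:R * Z.
  apply: le_trans cardle; rewrite cardE ler_sum// => v _.
  have := sum_pairwise_far_mem lam (finset.in_setT v).
  rewrite (eq_bigl pairwise_far); last by move=> I;
    rewrite finset.subsetT andbT.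
  move=> ->.
  rewrite (eq_bigr (fun I => w (I :\: nbhd v) * w (I :&: nbhd v) *
      (lam * expR (- (lam * #|unblocked (nbhd v) (I :\: nbhd v)|%:R)))));
        last first.
    by move=> I _; rewrite /w -exprD -cardsDI.
  rewrite (splitT v (fun J K =>
    w J * w K * (lam * expR (- (lam * #|unblocked (nbhd v) J|%:R))))).
  rewrite /partition_fun mulr_sumr ler_sum// => J _.
  rewrite -mulr_suml -mulr_sumr -/(w J).
  rewrite mulrCA -mulrA ler_pM2l// ler_piMr//.
  rewrite expRN ler_pdivrMr ?expR_gt0// mul1r.
  exact: partition_fun_le_expR.
have [yY|Yy] := leP (#|V|%:R * Z * Y) y.
  left; rewrite -(ler_pM2r Z0); apply: le_trans neighbours.
  rewrite (_ : _ * Z = (1 - lam * D) * (#|V|%:R * Z * Y)); last by ring.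
  by rewrite ler_wpM2l// subr_ge0.
right; rewrite -(ler_pM2r Z0); apply: le_trans centre.
apply: (@le_trans _ _ (\sum_(v : V) \sum_(I | pairwise_far I)
    w I * (lam * (expR (- Y) * (1 + Y - lam * #|T I v|%:R))))); last first.
  apply: ler_sum => v _; apply: ler_sum => I _.
  rewrite ler_wpM2l// ler_pM2l//.
  rewrite [X in _ <= expR X](_ : _ = - Y + (Y - lam * #|T I v|%:R));
    last by ring.
  by rewrite expRD ler_pM2l ?expR_gt0// -addrA expR_ge1Dx.
have -> : \sum_(v : V) \sum_(I | pairwise_far I)
    w I * (lam * (expR (- Y) * (1 + Y - lam * #|T I v|%:R))) =
    lam * expR (- Y) * ((1 + Y) * (#|V|%:R * Z) - y).
  rewrite /y mulrBr.
  have -> : #|V|%:R * Z = \sum_(v : V) \sum_(I | pairwise_far I) w I.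
    by rewrite sumr_const mulr_natl.
  rewrite !mulr_sumr -sumrB; apply: eq_bigr => v _.
  rewrite !mulr_sumr -sumrB; apply: eq_bigr => I _; ring.
rewrite (_ : #|V|%:R * (lam * expR (- Y)) * Z = lam * expR (- Y) * (#|V|%:R *
  Z)); last by ring.
rewrite ler_pM2l ?mulr_gt0 ?expR_gt0//.
rewrite (_ : (1 + Y) * _ - y = #|V|%:R * Z + (#|V|%:R * Z * Y - y));
  last by ring.
by rewrite lerDl subr_ge0 ltW.
Qed.

End hard_core.

Local Open Scope classical_set_scope.

(** * Volume in Euclidean space *)

(** Makes the right-hand sides of the scaling formulas below into measures, so that uniqueness
    theorems apply to them. *)
Lemma scaled_pushforward_measure (R : realType) d1 d2
    (T1 : measurableType d1) (T2 : measurableType d2)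
    (mu : {measure set T1 -> \bar R}) (f : T1 -> T2) (a : R) :
  measurable_fun setT f -> 0 <= a ->
  exists m : {measure set T2 -> \bar R},
    forall A, m A = (a%:E * mu (f @^-1` A))%E.
Proof.
move=> mf a0.
unshelve eexists (mscale (NngNum a0) (pushforward mu f : {measure set T2 ->
  \bar R}) : {measure set T2 -> \bar R}).
  exact: mf.
by [].
Qed.

(** * Lebesgue measure under scaling and translation *)

Section affine.
Context {R : realType}.
Local Notation T := (measurableTypeR R).

Lemma measurable_affine (a b : R) :
  measurable_fun setT ((fun x => a * x + b) : T -> T).
Proof. by apply: measurable_funD => //; exact: mulrl_measurable. Qed.

Lemma lebesgue_measure_affine (a b : R) (A : set T) : 0 < a -> measurable A ->
  lebesgue_measure A =
    (a%:E * lebesgue_measure [set x : T | A (a * x + b)%R])%E.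
Proof.
move=> a0 mA.
have [m mE] := scaled_pushforward_measure lebesgue_measure (measurable_affine
  a b) (ltW a0).
rewrite -[RHS]mE;
  apply: (lebesgue_measure_unique (mu := m)) => // X [[x y] _ <-].
rewrite mE /=.
rewrite (_ : _ @^-1` _ = `](x - b) / a, (y - b) / a]%classic); last first.
  apply/seteqP; split => z /=; rewrite !in_itv/=.
    by rewrite ltr_pdivrMr// ler_pdivlMr// ltrBlDr lerBrDr mulrC.
  by rewrite ltr_pdivrMr// ler_pdivlMr// ltrBlDr lerBrDr mulrC.
rewrite !lebesgue_measure_itv/= !lte_fin ltr_pM2r ?invr_gt0// ltrD2r.
case: ifP => _; last by rewrite mule0.
rewrite -!EFinD -EFinM; congr EFin; field.
by rewrite gt_eqF.
Qed.

Definition affine_tuple n (a : R) (b : 'I_n -> R) (t : n.-tuple T) : n.-tuple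
  T :=
  [tuple (a * tnth t i + b i : R) | i < n].

Lemma measurable_affine_tuple n a (b : 'I_n -> R) :
  measurable_fun setT (affine_tuple a b).
Proof.
apply/measurable_fun_tnthP => i.
rewrite (_ : _ \o _ = (fun x : T => a * x + b i : T) \o (fun t => tnth t i)).
  by apply: measurableT_comp; [exact: measurable_affine|exact: measurable_tnth].
by apply/funext => t /=; rewrite tnth_mktuple.
Qed.

(** Induction on [n]: through [cons_pair] the map becomes a product [g] of a one-dimensional and an
    [n]-dimensional affine map, and by uniqueness of product measures it suffices to compare on
    rectangles. *)
Lemma lebesgue_tuple_affine n a (b : 'I_n -> R) (A : set (n.-tuple T)) :
  0 < a -> measurable A ->
  lebesgue_tuple A =
    ((a ^+ n)%:E * lebesgue_tuple (affine_tuple a b @^-1` A))%E.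
Proof.
move=> a0; elim: n b A => [|n IH] b A mA.
  have E : affine_tuple a b [tuple] = [tuple] by apply: eq_from_tnth => -[].
  rewrite expr0 mul1e /= !diracE; congr (_%:R%:E); congr nat_of_bool.
  by apply/idP/idP; rewrite !inE/= E.
pose g (p : T * n.-tuple T) : T * n.-tuple T :=
  (a * p.1 + b ord0, affine_tuple a (fun i => b (lift ord0 i)) p.2).
have mg : measurable_fun setT g.
  apply: measurable_fun_pair.
    by apply: (measurableT_comp (measurable_affine a (b ord0))).
  by apply: (measurableT_comp (measurable_affine_tuple a _)).
have mc : measurable_fun setT (@cons_pair T n).
  exact: (measurable_cons measurable_fst measurable_snd).
have [m mE] := scaled_pushforward_measure
  (lebesgue_measure \x @lebesgue_tuple R n)%E mg
  (exprn_ge0 n.+1 (ltW a0)).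
transitivity (m (@cons_pair T n @^-1` A)); last first.
  have E p : cons_pair (g p) = affine_tuple a b (cons_pair p).
    apply/eq_from_tnth => i; rewrite tnth_mktuple /g /cons_pair /=.
    have [j ->|->] := unliftP ord0 i; last by rewrite !tnth0.
    by rewrite !tnthS /= tnth_mktuple.
  have EA : g @^-1` (@cons_pair T n @^-1` A) =
      @cons_pair T n @^-1` (affine_tuple a b @^-1` A).
    by apply/seteqP; split => p /=; rewrite E.
  by rewrite mE EA.
apply: (product_measure_unique (m1 := lebesgue_measure)
  (m2 := @lebesgue_tuple R n)).
- move=> B C mB mC; rewrite mE.
  have -> : g @^-1` (B `*` C) = [set x : T | B (a * x + b ord0)] `*`
     (affine_tuple a (fun i => b (lift ord0 i)) @^-1` C).
    by apply/seteqP; split.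
  have mB' : measurable [set x : T | B (a * x + b ord0)].
    by rewrite -[X in measurable X]setTI; exact: measurable_affine.
  have mC' : measurable (affine_tuple a (fun i => b (lift ord0 i)) @^-1` C).
    by rewrite -[X in measurable X]setTI; exact: measurable_affine_tuple.
  transitivity ((a ^+ n.+1)%:E *
    (lebesgue_measure [set x : T | (B (a * x + b ord0))%R] *
    lebesgue_tuple (affine_tuple a (fun i => b (lift ord0 i)) @^-1` C)))%E.
    congr (_ * _)%E; exact: product_measure1E.
  transitivity (lebesgue_measure B * lebesgue_tuple C)%E; last by [].
  rewrite (lebesgue_measure_affine (b ord0) a0 mB)
    (IH (fun i => b (lift ord0 i)))//.
  by rewrite exprS EFinM muleACA.
- by rewrite -[X in measurable X]setTI; exact: mc.
Qed.

End affine.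

(** * Volume bounds on the size of disjoint and of covering families *)

Section finite_families.
Context d (T : measurableType d) (R : realType).
Variable mu : {measure set T -> \bar R}.
Context (F : finType) (D : {set F}) (A : F -> set T) (B : set T) (v : R).
Context (mA : forall f, f \in D -> measurable (A f)) (mB : measurable B).
Context (muA : forall f, f \in D -> mu (A f) = v%:E).

Let sum_muA : (\sum_(f \in [set` D]) mu (A f) = (#|D|%:R * v)%:E)%E.
Proof.
have -> : [set` D] = [set` enum D].
  by apply/seteqP; split => f /=; rewrite mem_enum.
rewrite -fsbig_seq ?enum_uniq// big_enum/= (eq_bigr (fun=> v%:E))//.
by rewrite sumEFin sumr_const mulr_natl.
Qed.

Lemma card_mul_le_measure :
  trivIset [set` D] A -> (forall f, f \in D -> A f `<=` B) ->
  ((#|D|%:R * v)%:E <= mu B)%E.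
Proof.
move=> tA AB; rewrite -sum_muA -measure_fin_bigcup//.
apply: le_measure; rewrite ?inE//.
  exact: fin_bigcup_measurable.
by move=> t [f fD]; exact: AB.
Qed.

Lemma measure_le_card_mul :
  B `<=` \bigcup_(f in [set` D]) A f -> (mu B <= (#|D|%:R * v)%:E)%E.
Proof. by move=> BA; rewrite -sum_muA; exact: content_sub_fsum. Qed.

End finite_families.

(** * Euclidean norm, cells and balls *)

Section euclidean.
Context {R : realType} {d : nat}.
Implicit Types (x y z : 'rV[R]_d) (r s : R).

Lemma enorm_ge0 x : 0 <= enorm x.
Proof. exact: sqrtr_ge0. Qed.

Lemma enorm_le x r : 0 <= r ->
  (enorm x <= r) = (\sum_i x ord0 i ^+ 2 <= r ^+ 2).
Proof.
move=> r0; rewrite /enorm -{1}(ger0_norm r0) -sqrtr_sqr ler_sqrt//.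
exact: sqr_ge0.
Qed.

Lemma enorm_sqr x : enorm x ^+ 2 = \sum_i x ord0 i ^+ 2.
Proof. by rewrite sqr_sqrtr// sumr_ge0// => i _; exact: sqr_ge0. Qed.

Lemma enormN x : enorm (- x) = enorm x.
Proof. by congr Num.sqrt; apply: eq_bigr => i _; rewrite mxE sqrrN. Qed.

Lemma enorm0 : enorm (0 : 'rV[R]_d) = 0.
Proof. by rewrite /enorm big1 ?sqrtr0// => i _; rewrite mxE expr0n. Qed.

Lemma enormB x y : enorm (x - y) = enorm (y - x).
Proof. by rewrite -enormN opprB. Qed.

Lemma coord_le_enorm x i : `|x ord0 i| <= enorm x.
Proof.
rewrite -sqrtr_sqr ler_sqrt; last by rewrite sumr_ge0// => j _; exact: sqr_ge0.
by rewrite (bigD1 i)//= lerDl sumr_ge0// => j _; exact: sqr_ge0.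
Qed.

Lemma cauchy_schwarz x y :
  \sum_i x ord0 i * y ord0 i <= enorm x * enorm y.
Proof.
have [x0|x0] := eqVneq (enorm x) 0.
  rewrite x0 mul0r big1// => i _.
  have := coord_le_enorm x i; rewrite x0 normr_le0 => /eqP ->.
  by rewrite mul0r.
have [y0|y0] := eqVneq (enorm y) 0.
  rewrite y0 mulr0 big1// => i _.
  have := coord_le_enorm y i; rewrite y0 normr_le0 => /eqP ->.
  by rewrite mulr0.
have {}x0 : 0 < enorm x by rewrite lt0r x0 enorm_ge0.
have {}y0 : 0 < enorm y by rewrite lt0r y0 enorm_ge0.
(* With [a], [b] the two norms and [c] the inner product, this sum equals
   [2 * (a * b) * (a * b - c)]. *)
have : 0 <= \sum_i (enorm y * x ord0 i - enorm x * y ord0 i) ^+ 2.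
  by apply: sumr_ge0 => i _; exact: sqr_ge0.
rewrite (eq_bigr (fun i => enorm y ^+ 2 * x ord0 i ^+ 2 +
  enorm x ^+ 2 * y ord0 i ^+ 2
  - 2 * enorm x * enorm y * (x ord0 i * y ord0 i))); last by move=> i _; ring.
rewrite sumrB big_split/= -!mulr_sumr -!enorm_sqr.
set a := enorm x in x0 *; set b := enorm y in y0 *; set c := \sum_i _ => h.
have : 0 <= 2 * (a * b) * (a * b - c) by nra.
by rewrite pmulr_rge0 ?subr_ge0// mulr_gt0// mulr_gt0.
Qed.

Lemma enorm_triangle x y : enorm (x + y) <= enorm x + enorm y.
Proof.
rewrite enorm_le ?addr_ge0 ?enorm_ge0//.
rewrite (eq_bigr (fun i => x ord0 i ^+ 2 + y ord0 i ^+ 2 +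
  2 * (x ord0 i * y ord0 i))).
  rewrite 2!big_split/= -mulr_sumr -!enorm_sqr sqrrD.
  have := cauchy_schwarz x y; set c := \sum_i _; lra.
by move=> i _; rewrite mxE; ring.
Qed.

(** Half-open cubes, so that the translates by a lattice of mesh [p] tile the space without
    overlap. *)
Definition cell z (p : R) : set 'rV[R]_d :=
  [set y | forall i, z ord0 i <= y ord0 i < z ord0 i + p].

(** The factor [d] is a crude replacement for its square root; the loss is harmless once the radius
    is [d ^ 3] grid steps. *)
Lemma cell_diam z p y : 0 <= p -> cell z p y -> enorm (y - z) <= d%:R * p.
Proof.
move=> p0 zy; rewrite enorm_le ?mulr_ge0//.
apply: (@le_trans _ _ (\sum_(i < d) p ^+ 2)).
  apply: ler_sum => i _; rewrite !mxE.
  have /andP[h1 h2] := zy i.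
  by apply: lerXn2r; rewrite ?nnegrE ?subr_ge0// lerBlDl ltW.
rewrite sumr_const card_ord -[leLHS]mulr_natl exprMn ler_wpM2r ?sqr_ge0//.
by rewrite -natrX ler_nat; case: d => // n; rewrite -mulnn leq_pmulr.
Qed.

Definition row_of_tuple (t : d.-tuple (measurableTypeR R)) : 'rV[R]_d :=
  \row_(i < d) tnth t i.

Definition rV_measurable (A : set 'rV[R]_d) :=
  measurable (row_of_tuple @^-1` A).

Lemma rV_measurable_box (A : 'I_d -> set (measurableTypeR R)) :
  (forall i, measurable (A i)) ->
  rV_measurable [set y | forall i, A i (y ord0 i)].
Proof.
move=> mA; rewrite /rV_measurable.
rewrite (_ : _ @^-1` _ = \bigcap_(i in [set: 'I_d])
  ((fun t : d.-tuple (measurableTypeR R) => tnth t i) @^-1` A i)).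
  apply: fin_bigcap_measurable => // i _.
  rewrite -[X in measurable X]setTI; exact: measurable_tnth.
apply/seteqP; split => t /= h i => [_|].
  by have := h i; rewrite mxE.
by rewrite mxE; exact: (h i Logic.I).
Qed.

Lemma cellE z p : cell z p = [set y | forall i, `[z ord0 i, z ord0 i +
  p[%classic (y ord0 i)].
Proof. by apply/seteqP; split => y h i; have := h i; rewrite /= in_itv. Qed.

Lemma rV_measurable_cell z p : rV_measurable (cell z p).
Proof.
rewrite cellE.
apply: (rV_measurable_box (A := fun i => `[z ord0 i, z ord0 i + p[%classic))
  => i.
exact: measurable_itv.
Qed.

Lemma vol_cell z p : 0 < p -> vol (cell z p) = (p ^+ d)%:E.
Proof.
move=> p0; rewrite /vol.
rewrite (_ : [set t | _] = [set t : d.-tuple (measurableTypeR R) |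
   forall i, `[z ord0 i, z ord0 i + p[%classic (tnth t i)]).
  rewrite (lebesgue_tuple_box (A := fun i =>
    `[z ord0 i, z ord0 i + p[%classic)).
    rewrite (eq_bigr (fun=> p%:E));
      first by rewrite prodEFin prodr_const card_ord.
    move=> i _; rewrite lebesgue_measure_itv/= lte_fin ltrDl p0 -EFinB.
    by rewrite addrAC subrr add0r.
  by move=> i; exact: measurable_itv.
rewrite cellE; apply/seteqP; split => t /= h i; have := h i; by rewrite mxE.
Qed.

Lemma rV_measurable_ball x r : 0 <= r -> rV_measurable (closed_eball x r).
Proof.
move=> r0.
pose f (t : d.-tuple (measurableTypeR R)) : R :=
  \sum_i (tnth t i - x ord0 i) ^+ 2.
rewrite /rV_measurable (_ : _ @^-1` _ = f @^-1` `]-oo, r ^+ 2]%classic).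
  rewrite -[X in measurable X]setTI.
  suff mf : measurable_fun setT f by apply: mf => //; exact: measurable_itv.
  apply: measurable_sum => i; apply: measurable_funX.
  by apply: measurable_funB => //; exact: measurable_tnth.
have fE t : \sum_i (row_of_tuple t - x) ord0 i ^+ 2 = f t.
  by apply: eq_bigr => i _; rewrite !mxE.
by apply/seteqP; split => t /=; rewrite /closed_eball in_itv/= enorm_le// fE.
Qed.

Lemma volE A : vol A = lebesgue_tuple (row_of_tuple @^-1` A).
Proof. by []. Qed.

Lemma vol_affine (a : R) x (A : set 'rV[R]_d) : 0 < a -> rV_measurable A ->
  vol A = ((a ^+ d)%:E * vol [set y | A (a *: y + x)%R])%E.
Proof.
move=> a0 mA; rewrite !volE (lebesgue_tuple_affine (fun i => x ord0 i) a0 mA).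
congr (_ * lebesgue_tuple _)%E; apply/funext => t /=; congr A.
by apply/rowP => i; rewrite !mxE tnth_mktuple.
Qed.

Lemma vol_le (A B : set 'rV[R]_d) : rV_measurable A -> rV_measurable B ->
  A `<=` B -> (vol A <= vol B)%E.
Proof.
by move=> mA mB AB; rewrite !volE le_measure ?inE// => t; exact: AB.
Qed.

Definition ball_volume : R := fine (vol (closed_eball (0 : 'rV[R]_d) 1)).

(** The volume is finite, so [fine] loses nothing: the unit ball lies in a cube of side 4. *)
Lemma ball_volumeE : (ball_volume%:E = vol (closed_eball (0 : 'rV[R]_d) 1))%E.
Proof.
rewrite /ball_volume fineK// ge0_fin_numE ?volE//.
rewrite (@le_lt_trans _ _ (vol (cell (const_mx (-2)) 4)))//; last first.
  by rewrite vol_cell ?ltry.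
apply: vol_le; [exact: rV_measurable_ball|exact: rV_measurable_cell|].
move=> y; rewrite /closed_eball/= subr0 => y1 i; rewrite !mxE.
have := le_trans (coord_le_enorm y i) y1; rewrite ler_norml => /andP[? ?].
by apply/andP; split; lra.
Qed.

Lemma vol_ball x r : 0 < r ->
  vol (closed_eball x r) = (ball_volume * r ^+ d)%:E.
Proof.
move=> r0; rewrite (vol_affine x r0); last exact: rV_measurable_ball (ltW r0).
rewrite mulrC EFinM ball_volumeE; congr (_ * vol _)%E.
suff E y : (enorm (r *: y) <= r) = (enorm y <= 1).
  by apply/seteqP; split => y; rewrite /closed_eball /= addrK subr0 E.
rewrite !enorm_le ?(ltW r0)// expr1n.
rewrite (eq_bigr (fun i => r ^+ 2 * y ord0 i ^+ 2)).
  by rewrite -mulr_sumr ger_pMr ?exprn_gt0.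
by move=> i _; rewrite mxE exprMn.
Qed.

Lemma ball_volume_gt0 : (0 < d)%N -> 0 < ball_volume.
Proof.
move=> d0; have d0' : 0 < d%:R :> R by rewrite ltr0n.
have : (vol (cell 0 1) <= vol (closed_eball (0 : 'rV[R]_d) d%:R))%E.
  apply: vol_le; [exact: rV_measurable_cell|exact: rV_measurable_ball|].
  by move=> y /cell_diam; rewrite /closed_eball mulr1; apply.
rewrite vol_cell// vol_ball// lee_fin expr1n => h.
by rewrite -(pmulr_lgt0 _ (exprn_gt0 d d0')) (lt_le_trans _ h).
Qed.

(** The unit cells at the points are disjoint and, having diameter at most [d], lie in the ball of
    radius [s + d]; compare volumes. *)
Lemma card_ball_le (F : finType) (D : {set F}) (p : F -> 'rV[R]_d) x s :
  (0 < d)%N -> 0 <= s ->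
  (forall f, f \in D -> enorm (p f - x) <= s) ->
  (forall f g, f \in D -> g \in D ->
    cell (p f) 1 `&` cell (p g) 1 !=set0 -> f = g) ->
  #|D|%:R <= ball_volume * (s + d%:R) ^+ d.
Proof.
move=> d0 s0 Ds Dinj; have sd0 : 0 < s + d%:R by rewrite ltr_wpDl// ltr0n.
rewrite -lee_fin -(vol_ball x)// -[X in (X%:E <= _)%E]mulr1 volE.
apply: (@card_mul_le_measure _ _ _ _ _ D
  (fun f => row_of_tuple @^-1` cell (p f) 1)).
- by move=> f _; exact: rV_measurable_cell.
- exact: rV_measurable_ball (ltW sd0).
- by move=> f _; have := vol_cell (p f) ltr01; rewrite expr1n.
- by move=> f g /= fD gD [t /= [tf tg]]; apply: Dinj => //;
  exists (row_of_tuple t).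
- move=> f fD t /= /(cell_diam ler01); rewrite mulr1 /closed_eball/= => h.
  rewrite -(subrKA (p f)) (le_trans (enorm_triangle _ _))//.
  by rewrite addrC lerD ?Ds.
Qed.

End euclidean.

Arguments ball_volume : clear implicits.

(** * Periodic packings *)

Lemma bernoulli_le (R : realDomainType) (t : R) n : 0 <= t <= 1 ->
  1 - n%:R * t <= (1 - t) ^+ n.
Proof.
move=> /andP[t0 t1]; elim: n => [|n IH]; first by rewrite mul0r subr0 expr0.
rewrite exprS; have n0 : 0 <= n%:R * (t * t) :> R by rewrite !mulr_ge0.
apply: (@le_trans _ _ ((1 - t) * (1 - n%:R * t))); last first.
  by rewrite ler_wpM2l// subr_ge0.
rewrite -addn1 natrD; lra.
Qed.

Section periodic_packing.
Context {R : realType} {d : nat} (F : finType) (D : {set F}).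
Context (p : F -> 'rV[R]_d) (r P b : R).
Context (d_gt0 : (0 < d)%N) (r_gt0 : 0 < r) (P_gt0 : 0 < P).

Definition lattice_pt (z : {ffun 'I_d -> int}) : 'rV[R]_d :=
  P *: \row_i (z i)%:~R.

Context (p_sep : forall f g z w, f \in D -> g \in D ->
  enorm (p f + lattice_pt z - (p g + lattice_pt w)) <= 2 * r -> f = g /\ z = w).
Context (p_bound : forall f, f \in D -> enorm (p f) <= b).

Definition periodic_centres : set 'rV[R]_d :=
  [set x | exists z f, f \in D /\ x = p f + lattice_pt z].

(** Even the closed balls are disjoint, so the volumes of the balls making up [covered] add up
    exactly. *)
Let balls_disjoint f g z w y : f \in D -> g \in D ->
  closed_eball (p f + lattice_pt z) r y ->
  closed_eball (p g + lattice_pt w) r y -> f = g /\ z = w.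
Proof.
move=> fD gD; rewrite /closed_eball/= => h1 h2; apply: p_sep => //.
rewrite -(subrKA y) (le_trans (enorm_triangle _ _))//.
rewrite (_ : 2 * r = r + r); last by rewrite mulr2n mulrDl mul1r.
by rewrite lerD// enormB.
Qed.

Lemma periodic_sphere_packing : sphere_packing periodic_centres r.
Proof.
split=> //; apply/trivIsetP => x y [z [f [fD ->]]] [w [g [gD ->]]] /eqP xy.
apply/seteqP; split => // t [/ltW h1 /ltW h2]; apply: xy.
by have [-> ->] := balls_disjoint fD gD h1 h2.
Qed.

Lemma rV_measurable_periodic : rV_measurable (covered periodic_centres r).
Proof.
pose G (u : {ffun 'I_d -> int} * F) : set (d.-tuple (measurableTypeR R)) :=
  if u.2 \in D then row_of_tuple @^-1` closed_eball (p u.2 + lattice_pt u.1) r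
  else set0.
rewrite /rV_measurable (_ : _ @^-1` _ = \bigcup_u G u).
  apply: countable_bigcupT_measurable => [|u]; first exact: countableP.
  by rewrite /G; case: ifP => // _; apply: rV_measurable_ball; exact: ltW.
apply/seteqP; split => t.
  by move=> [x [z [f [fD ->]]] xt]; exists (z, f) => //; rewrite /G fD.
move=> [[z f] _]; rewrite /G/=; case: ifP => // fD h.
by exists (p f + lattice_pt z) => //; exists z, f.
Qed.

(** Boundary margin: a centre's offset in its period, the ball radius, and the diameter of a lattice
    cell. *)
Let c : R := b + r + d%:R * P.

(** The cells of the lattice points within [rho - b - r] of the origin cover the ball of radius
    [rho - c], which bounds their number from below. Each such point carries [#|D|] disjoint balls
    inside the ball of radius [rho]. *)
Lemma vol_covered_ge rho : c < rho ->
  (((#|D|%:R * ball_volume R d * r ^+ d / P ^+ d) *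
     (ball_volume R d * (rho - c) ^+ d))%:E <=
   vol (covered periodic_centres r `&` closed_eball (0 : 'rV[R]_d) rho))%E.
Proof.
move=> crho; have V0 := @ball_volume_gt0 R d d_gt0.
have [D0|/set0Pn[f0 f0D]] := eqVneq D finset.set0.
  by rewrite D0 cards0 !mul0r volE measure_ge0.
have b0 : 0 <= b := le_trans (enorm_ge0 _) (p_bound f0D).
have c0 : 0 < c by rewrite /c ltr_wpDr ?mulr_ge0 ?(ltW P_gt0)// ltr_wpDl.
have rho0 : 0 < rho := lt_trans c0 crho.
(* Lattice coordinates from [-K] to [K] suffice, which gives a finite index type. *)
pose K := Num.bound (rho / P).
have rhoK : rho / P < K%:R by apply: archi_boundP; rewrite divr_ge0// ltW.
pose zz (k : {ffun 'I_d -> 'I_(2 * K).+1}) : {ffun 'I_d -> int} :=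
  [ffun i => (k i)%:Z - K%:Z].
have zz_inj : injective zz.
  move=> k l /ffunP kl; apply/ffunP => i; apply: val_inj => /=.
  by have := kl i; rewrite !ffunE => /addIr [].
pose Zs := [set k | enorm (lattice_pt (zz k)) <= rho - b - r]%SET.
have cover : closed_eball (0 : 'rV[R]_d) (rho - c) `<=`
    \bigcup_(k in [set` Zs]) cell (lattice_pt (zz k)) P.
  move=> y; rewrite /closed_eball/= subr0 => hy.
  have yi i : `|y ord0 i / P| < K%:R.
    rewrite normrM normfV (gtr0_norm P_gt0) (le_lt_trans _ rhoK)//.
    rewrite ler_pM2r ?invr_gt0// (le_trans (coord_le_enorm y i))//.
    by rewrite (le_trans hy)// gerBl ltW.
  pose fl i := Num.floor (y ord0 i / P).
  have flK i : (0 <= fl i + K%:Z)%R /\ (`|(fl i + K%:Z)%R|%N < (2 * K).+1)%N.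
    have /andP[h1 h2] := floor_itv (y ord0 i / P).
    have := yi i; rewrite ltr_norml => /andP[h3 h4].
    have h5 : (- K%:Z < fl i + 1)%R.
      by rewrite -(ltr_int R) (lt_trans _ h2)// mulrNz.
    have h6 : (fl i < K%:Z)%R by rewrite -(ltr_int R) (le_lt_trans h1).
    have h7 : (0 <= fl i + K%:Z)%R by rewrite -ltzD1 addrAC -ltrBlDr sub0r.
    split=> //; rewrite -ltz_nat gez0_abs//.
    rewrite -addn1 PoszD ltzD1 mul2n -addnn PoszD lerD2r; exact: ltW.
  pose k : {ffun 'I_d -> 'I_(2 * K).+1} := [ffun i => Ordinal (flK i).2].
  have zzk i : zz k i = fl i.
    by rewrite !ffunE/= gez0_abs ?addrK//; have [] := flK i.
  have yk : cell (lattice_pt (zz k)) P y.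
    move=> i; rewrite !mxE zzk.
    have /andP[h1 h2] := floor_itv (y ord0 i / P).
    rewrite mulrC -ler_pdivlMr// h1/=.
    rewrite (_ : _ * P + P = (fl i + 1)%:~R * P) -?ltr_pdivrMr//.
    by rewrite intrD mulrDl mul1r.
  exists k => //=; rewrite inE.
  have := cell_diam (ltW P_gt0) yk; rewrite enormB => h.
  have := enorm_triangle (lattice_pt (zz k) - y) y; rewrite subrK => h'.
  by move: hy; rewrite /c; lra.
have count : ball_volume R d * (rho - c) ^+ d <= #|Zs|%:R * P ^+ d.
  rewrite -lee_fin -(vol_ball 0) ?subr_gt0// volE.
  apply: (@measure_le_card_mul _ _ _ (@lebesgue_tuple R d) _ Zs
    (fun k => row_of_tuple @^-1` cell (lattice_pt (zz k)) P)).
  - by move=> k _; exact: rV_measurable_cell.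
  - by apply: rV_measurable_ball; rewrite ltW ?subr_gt0.
  - by move=> k _; exact: (vol_cell (lattice_pt (zz k)) P_gt0).
  - by move=> t /cover[k kZ tk]; exists k.
apply: (@le_trans _ _ ((#|finset.setX Zs D|%:R *
  (ball_volume R d * r ^+ d))%:E)).
  rewrite lee_fin cardsX natrM.
  have -> : #|D|%:R * ball_volume R d * r ^+ d / P ^+ d * (ball_volume R d *
    (rho - c) ^+ d)
     = (#|D|%:R * (ball_volume R d * r ^+ d)) * ((ball_volume R d * (rho - c)
       ^+ d) / P ^+ d).
    by ring.
  rewrite (_ : #|Zs|%:R * _ * _ = (#|D|%:R * (ball_volume R d * r ^+ d)) *
    #|Zs|%:R); last by ring.

  rewrite ler_wpM2l//.
    by rewrite mulr_ge0// mulr_ge0 ?exprn_ge0 ?ltW.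
  by rewrite ler_pdivrMr ?exprn_gt0.
rewrite volE; apply: (@card_mul_le_measure _ _ _ (@lebesgue_tuple R d) _
  (finset.setX Zs D)
  (fun u => row_of_tuple @^-1` closed_eball (p u.2 + lattice_pt (zz u.1)) r)).
- by move=> u _; exact: rV_measurable_ball (ltW r_gt0).
- rewrite preimage_setI; apply: measurableI;
  first exact: rV_measurable_periodic.
  exact: rV_measurable_ball (ltW rho0).
- by move=> u _; exact: (vol_ball (p u.2 + lattice_pt (zz u.1)) r_gt0).
- move=> [k f] [l g] /=; rewrite !inE/= => /andP[_ fD] /andP[_ gD] [t [h1 h2]].
  by have [-> /zz_inj ->] := balls_disjoint fD gD h1 h2.
- move=> [k f]; rewrite !inE/= => /andP[kZ fD] t /= h; split => /=.
    by exists (p f + lattice_pt (zz k)) => //; exists (zz k), f.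
  move: h; rewrite /closed_eball/= subr0 => h.
  have := enorm_triangle (row_of_tuple t - (p f + lattice_pt (zz k)))
    (p f + lattice_pt (zz k)).
  rewrite subrK; have := enorm_triangle (p f) (lattice_pt (zz k)).
  by have := p_bound fD; lra.
Qed.

Lemma periodic_packing_density :
  ((#|D|%:R * ball_volume R d * r ^+ d / P ^+ d)%:E <= packing_density R d)%E.
Proof.
have V0 := @ball_volume_gt0 R d d_gt0.
apply: (@le_trans _ _ (upper_density (covered periodic_centres r))); last first.
  apply: ereal_sup_ubound; exists periodic_centres, r; split => //.
  exact: periodic_sphere_packing.
rewrite /upper_density limf_esupE;
  apply: le_ereal_inf_tmp => _ [A [M [Mreal AM]] <-].
set L := (#|D|%:R * _ * _ / _).
have L0 : 0 <= L.
  by rewrite /L divr_ge0 ?exprn_ge0 ?(ltW P_gt0)// mulr_ge0 ?exprn_ge0 ?(ltW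
    r_gt0)// mulr_ge0// ltW.
apply/lee_addgt0Pr => e0 e0_gt0; pose e : R := e0.
have e_gt0 : 0 < e := e0_gt0; rewrite -/e.
(* By Bernoulli's inequality the density at radius [rho] is at least [L - L * d * |c| / rho], and
   [rho >= X] makes the loss at most [e]. The absolute value is there because [c] may be negative
   when [D] is empty. *)
have [X XE] : exists X, X = d%:R * `|c| * L / e by eexists.
have X_ge0 : 0 <= X by rewrite XE divr_ge0 ?(ltW e_gt0)// mulr_ge0// mulr_ge0.
pose rho : R := 1 + `|M| + `|c| + X.
have rhoM : M < rho by have := ler_norm M; have := normr_ge0 c; rewrite /rho;
  lra.
have rhoc : `|c| < rho by have := normr_ge0 M; rewrite /rho; lra.
have rho0 : 0 < rho := le_lt_trans (normr_ge0 c) rhoc.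
have crho : c < rho := le_lt_trans (ler_norm c) rhoc.
apply: (@le_trans _ _ ((vol (covered periodic_centres r `&`
  closed_eball (0 : 'rV[R]_d) rho) /
   vol (closed_eball (0 : 'rV[R]_d) rho)) + e%:E)%E); last first.
  rewrite leeD2r//; apply: ereal_sup_ubound; exists rho => //; exact: AM.
rewrite (vol_ball _ rho0) inver mulf_eq0 (gt_eqF V0) expf_eq0 (gt_eqF rho0)
  andbF/=.
have := vol_covered_ge crho; rewrite -/L => h.
apply: (@le_trans _ _ ((L * (ball_volume R d * (rho - c) ^+ d))%:E *
  (ball_volume R d * rho ^+ d)^-1%:E + e%:E)%E).
  rewrite -EFinM -EFinD lee_fin.
  have -> : L * (ball_volume R d * (rho - c) ^+ d) *
    (ball_volume R d * rho ^+ d)^-1 = L * (1 - c / rho) ^+ d.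
    have -> : 1 - c / rho = (rho - c) / rho by field; rewrite gt_eqF.
    by rewrite expr_div_n; field; rewrite !gt_eqF ?exprn_gt0.
  rewrite -lerBlDr; apply: (@le_trans _ _ (L * (1 - `|c| / rho) ^+ d));
    last first.
    rewrite ler_wpM2l// lerXn2r ?nnegrE ?subr_ge0 ?ler_pdivrMr ?mul1r
      ?(ltW rhoc) ?(ltW crho)//.
    by rewrite lerB// ler_pM2r ?invr_gt0// ler_norm.
  apply: (@le_trans _ _ (L * (1 - d%:R * (`|c| / rho)))); last first.
    rewrite ler_wpM2l// bernoulli_le// divr_ge0 ?(ltW rho0)//=.
    by rewrite ler_pdivrMr// mul1r ltW.
  rewrite mulrBr mulr1 lerB//.
  rewrite (_ : L * _ = e * X / rho); last first.
    by rewrite XE; field; rewrite !gt_eqF.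
  rewrite ler_pdivrMr// ler_pM2l//.
  by rewrite /rho lerDr; have := normr_ge0 M; have := normr_ge0 c; lra.
rewrite leeD2r//; apply: lee_wpmul2r => //.
by rewrite lee_fin invr_ge0 mulr_ge0 ?exprn_ge0 ?ltW.
Qed.

End periodic_packing.

(** * Packings centred at grid points *)

Section grid.
Context {R : realType} (d M : nat) (r : R).
Context (d_gt0 : (0 < d)%N) (r_gt0 : 0 < r).
Local Notation V := {ffun 'I_d -> 'I_M}.

Definition grid_pt (f : V) : 'rV[R]_d := \row_i (f i)%:R.

Definition grid_close (f g : V) : bool :=
  enorm (grid_pt f - grid_pt g) <= 2 * r.

Lemma grid_close_refl : reflexive grid_close.
Proof. by move=> f; rewrite /grid_close subrr enorm0 mulr_ge0// ltW. Qed.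

Lemma grid_close_sym : symmetric grid_close.
Proof. by move=> f g; rewrite /grid_close enormB. Qed.

Lemma grid_cell_inj f g : cell (grid_pt f) 1 `&` cell (grid_pt g) 1 !=set0 ->
  f = g.
Proof.
move=> [y [yf yg]]; apply/ffunP => i; apply: val_inj => /=.
have := yf i; have := yg i; rewrite !mxE => /andP[h1 h2] /andP[h3 h4].
apply/eqP; rewrite eqn_leq; apply/andP.
split; rewrite -ltnS -(ltr_nat R) -natr1; first exact: le_lt_trans h3 h2.
exact: le_lt_trans h1 h4.
Qed.

Lemma card_grid_ball_le (S : {set V}) x s : 0 <= s ->
  (forall f, f \in S -> enorm (grid_pt f - x) <= s) ->
  #|S|%:R <= ball_volume R d * (s + d%:R) ^+ d.
Proof.
move=> s0 h; apply: (card_ball_le (x := x) (p := grid_pt)) => // f g _ _.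
exact: grid_cell_inj.
Qed.

Lemma card_grid_nbhd f :
  #|nbhd grid_close f|%:R <= ball_volume R d * (2 * r + d%:R) ^+ d.
Proof.
apply: (card_grid_ball_le (x := grid_pt f)) => [|g].
  by rewrite mulr_ge0// ltW.
by rewrite inE grid_close_sym.
Qed.

Lemma grid_locally_sparse f (T : {set V}) : T \subset nbhd grid_close f ->
  \sum_(u in T) #|T :&: nbhd grid_close u|%:R <=
  2 * (ball_volume R d * (Num.sqrt 3 * r + d%:R) ^+ d) * #|T|%:R.
Proof.
move=> Tf.
pose n u := enorm (grid_pt u - grid_pt f).
(* Of two close points of [T], one counts the other as no further from [f] than
   itself, and these lie in a ball of radius [sqrt 3 * r] about a midpoint. *)
pose near u := [set w in T | grid_close u w && (n w <= n u)]%SET.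
have near_le u : u \in T ->
    #|near u|%:R <= ball_volume R d * (Num.sqrt 3 * r + d%:R) ^+ d.
  move=> uT.
  have s0 : 0 <= Num.sqrt 3 * r by rewrite mulr_ge0 ?sqrtr_ge0// ltW.
  have un : n u <= 2 * r.
    by have := fintype.subsetP Tf u uT; rewrite inE grid_close_sym.
  apply: (card_grid_ball_le (x := 2^-1 *: (grid_pt f + grid_pt u))) => // w.
  rewrite inE => /andP[_ /andP[]]; rewrite /grid_close enormB => uw wu.
  rewrite enorm_le//.
  (* Apollonius' median identity for the midpoint of [f] and [u]. With [n w <= n u <= 2 * r] and [w]
     within [2 * r] of [u], the squared distance is at most
     [2 * r ^+ 2 + n u ^+ 2 / 4 <= 3 * r ^+ 2]. *)
  rewrite (eq_bigr (fun i => 2^-1 * (grid_pt w - grid_pt u) ord0 i ^+ 2 +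
     2^-1 * (grid_pt w - grid_pt f) ord0 i ^+ 2
     - 4^-1 * (grid_pt u - grid_pt f) ord0 i ^+ 2)); last first.
    by move=> i _; rewrite !mxE; field.
  have s3 : Num.sqrt 3 ^+ 2 = 3 :> R by rewrite sqr_sqrtr.
  rewrite sumrB big_split/= -!mulr_sumr -!enorm_sqr exprMn s3.
  rewrite -/(n w) -/(n u).
  have n0 v : 0 <= n v := enorm_ge0 _.
  have := enorm_ge0 (grid_pt w - grid_pt u); have := n0 w; have := n0 u.
  have h1 : enorm (grid_pt w - grid_pt u) ^+ 2 <= (2 * r) ^+ 2.
    by rewrite lerXn2r ?nnegrE ?enorm_ge0// mulr_ge0// ltW.
  have h2 : n w ^+ 2 <= n u ^+ 2 by rewrite lerXn2r ?nnegrE.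
  have h3 : n u ^+ 2 <= (2 * r) ^+ 2.
    by rewrite lerXn2r ?nnegrE// mulr_ge0// ltW.
  rewrite exprMn in h1 h3;  lra.
have cardE u : #|near u|%:R = \sum_(w in T) (grid_close u w && (n w <= n
  u))%:R :> R.
  rewrite -sum1_card natr_sum big_mkcond [RHS]big_mkcond/=.
  by apply: eq_bigr => w _; rewrite inE; case: (w \in T) => //=; case: ifP.
apply: (@le_trans _ _ (\sum_(u in T) #|near u|%:R + \sum_(u in T) #|near
  u|%:R)); last first.
  rewrite -mulr2n -[leLHS]mulr_natl -mulrA ler_wpM2l//.
  rewrite mulr_natr -sumr_const; exact: ler_sum.
(* Double counting: one copy of the sum is rewritten with the roles of the two points exchanged, so
   that together the copies count every close pair. *)
have swap : \sum_(u in T) #|near u|%:R =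
    \sum_(u in T) \sum_(w in T) (grid_close u w && (n u <= n w))%:R :> R.
  under eq_bigr do rewrite cardE.
  rewrite exchange_big/=; apply: eq_bigr => u _; apply: eq_bigr => w _.
  by rewrite grid_close_sym.
rewrite {2}swap -big_split/=; apply: ler_sum => u uT.
rewrite cardE -big_split/=.
have -> : #|T :&: nbhd grid_close u|%:R = \sum_(w in T) (grid_close u w)%:R :>
  R.
  rewrite -sum1_card natr_sum big_mkcond [RHS]big_mkcond/=.
  by apply: eq_bigr => w _; rewrite !inE; case: (w \in T) => //=; case: ifP.
apply: ler_sum => w _; case: (grid_close u w) => /=; last by rewrite addr0.
case: (leP (n w) (n u)) => [_|/ltW ->]; first by rewrite lerDl.
by rewrite add0r.
Qed.

(** The cube is repeated with period [M + 2 * r]. Coordinates within a cube differ by less than [M],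
    so points of different copies have some coordinate differing by more than [2 * r]. *)
Lemma grid_packing_density (I : {set V}) : pairwise_far grid_close I ->
  ((#|I|%:R * ball_volume R d * r ^+ d / (M%:R + 2 * r) ^+ d)%:E
    <= packing_density R d)%E.
Proof.
move=> /pairwise_farP sI.
have P0 : 0 < M%:R + 2 * r by rewrite ltr_wpDl// mulr_gt0.
apply: (periodic_packing_density (p := grid_pt) (b := \sum_(f : V) enorm
  (grid_pt f))) => //.
  move=> f g z w fI gI h.
  have zw : z = w.
    apply/ffunP => i; apply/eqP/negPn/negP => zwi.
    have := le_trans (coord_le_enorm _ i) h; rewrite !mxE.
    rewrite (_ : _ - _ = ((f i)%:R - (g i)%:R) +
      (M%:R + 2 * r) * (z i - w i)%:~R); last by rewrite intrB; ring.
    have fM : (f i)%:R < M%:R :> R by rewrite ltr_nat.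
    have gM : (g i)%:R < M%:R :> R by rewrite ltr_nat.
    have f0 : 0 <= (f i)%:R :> R by [].
    have g0 : 0 <= (g i)%:R :> R by [].
    have k1 : 1 <= `|(z i - w i)%:~R| :> R.
      by rewrite -intr_norm (ler_int R 1) -gtz0_ge1 normr_gt0 subr_eq0.
    have k2 := ler_wpM2l (ltW P0) k1;
      rewrite mulr1 -{2}(gtr0_norm P0) -normrM in k2.
    have := lerB_normD ((M%:R + 2 * r) * (z i - w i)%:~R) ((f i)%:R - (g i)%:R).
    rewrite addrC => k3 k4.
    have k5 : `|(f i)%:R - (g i)%:R| < M%:R :> R by rewrite ltr_norml; lra.
    by move: k2 k3 k4 k5; rewrite (addrC (_ * _)); lra.
  split=> //; apply: sI => //.
  by move: h; rewrite zw opprD addrACA subrr addr0.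
by move=> f _; rewrite (bigD1 f)//= lerDl sumr_ge0// => g _; exact: enorm_ge0.
Qed.

(** Here [a] is the fraction of grid points occupied by the set from [hard_core_occupancy]; the
    factor [M / (M + 2 * r)] is the price of the gaps between cubes. *)
Lemma grid_density (lam Y : R) : (0 < M)%N ->
  let D := 2 * (ball_volume R d * (Num.sqrt 3 * r + d%:R) ^+ d) in
  0 < lam -> lam * D <= 1 ->
  exists2 a : R,
    ((1 - lam * D) * Y <= a * (ball_volume R d * (2 * r + d%:R) ^+ d) \/
     lam * expR (- Y) <= a) &
    ((a * ball_volume R d * (M%:R * r / (M%:R + 2 * r)) ^+ d)%:E
      <= packing_density R d)%E.
Proof.
move=> M0 D lam0 lamD.
have [I sI IY] := hard_core_occupancy grid_close_refl grid_close_sym Y lam0 lamD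
  card_grid_nbhd grid_locally_sparse.
have cV : #|{: V}|%:R = M%:R ^+ d :> R by rewrite card_ffun !card_ord natrX.
have Md : 0 < M%:R ^+ d :> R by rewrite exprn_gt0// ltr0n.
exists (#|I|%:R / M%:R ^+ d); last first.
  have := grid_packing_density sI; congr (_%:E <= _)%E.
  rewrite !expr_div_n exprMn; field.
  by rewrite !lt0r_neq0// exprn_gt0// ltr_wpDl// mulr_gt0.
by case: IY; rewrite cV => h; [left|right];
  rewrite 1?mulrAC ler_pdivlMr// mulrC.
Qed.

End grid.

(** * Asymptotics *)

Lemma cvg_inv_natr (R : realType) : (n%:R^-1 : R) @[n --> \oo] --> (0 : R).
Proof.
by rewrite -(cvg_shiftS (fun n => n%:R^-1 : R)); exact: cvg_harmonic.
Qed.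

(** With [n = s ^+ 2], the bound [ln s < s] gives [ln n / n <= 2 / s]. *)
Lemma cvg_ln_div (R : realType) : (ln (n%:R : R) / n%:R) @[n --> \oo] --> (0 :
  R).
Proof.
apply: (@squeeze_cvgr _ _ _ _ (cst 0) (fun n => 2 * Num.sqrt (n%:R^-1 : R))).
- near=> n.
  have n1 : 1 <= n%:R :> R by rewrite ler1n; near: n; exists 1%N.
  have n0 : 0 < n%:R :> R by exact: lt_le_trans n1.
  apply/andP; split; first by rewrite divr_ge0// ln_ge0.
  have [s s0 [-> ->]] : exists2 s : R, 0 < s &
      n%:R = s ^+ 2 /\ Num.sqrt n%:R^-1 = s^-1.
    exists (Num.sqrt n%:R); first by rewrite sqrtr_gt0.
    by rewrite sqr_sqrtr ?(ltW n0)// sqrtrV ?(ltW n0).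
  rewrite lnXn// ler_pdivrMr ?exprn_gt0//.
  rewrite (_ : 2 / s * s ^+ 2 = s *+ 2); last by field; rewrite gt_eqF.
  by rewrite lerMn2r /= ltW// ln_sublinear.
- exact: cvg_cst.
- rewrite (_ : (0 : R) = 2 * Num.sqrt 0); last by rewrite sqrtr0 mulr0.
  apply: cvgM; first exact: cvg_cst.
  have := @continuous_cvg nat R R _ _ _ (@Num.sqrt R) 0 (@sqrt_continuous R 0)
    (@cvg_inv_natr R).
  by apply.
Unshelve. all: by end_near. Qed.

Section asymptotics.
Context {R : realType}.
Local Notation C := (ln (2 / Num.sqrt 3) : R).

Let sqrt3_gt0 : 0 < Num.sqrt 3 :> R.
Proof. by rewrite sqrtr_gt0. Qed.

Let sqr_sqrt3 : Num.sqrt 3 ^+ 2 = 3 :> R.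
Proof. by rewrite sqr_sqrtr. Qed.

Let sqrt3_ge1 : 1 <= Num.sqrt 3 :> R.
Proof. by rewrite -(@ler_pXn2r _ 2) ?nnegrE ?ltW// sqr_sqrt3 expr1n; lra. Qed.

Let C_gt0 : 0 < C.
Proof.
rewrite ln_gt0// ltr_pdivlMr// mul1r -(@ltr_pXn2r _ 2) ?nnegrE ?ltW// sqr_sqrt3.
lra.
Qed.

Let C_le2 : C <= 2.
Proof.
have x0 : 0 < 2 / Num.sqrt 3 :> R by rewrite divr_gt0.
by rewrite (le_trans (ltW (ln_sublinear x0)))// ler_pdivrMr// ler_peMr.
Qed.

(* One factor [1 - 1/d] each is lost to [lam * D = 1/d], to the gap between
   consecutive cubes and to the grid width; the logarithm comes from the choice
   [Y = C * d - 4 * ln d], where [4 * ln d] absorbs the polynomial factors. *)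
Definition density_error (d : nat) : R :=
  (1 - d%:R^-1) ^+ 3 * (1 - 4 / C * (ln d%:R / d%:R)) - 1.

Lemma cvg_density_error : density_error n @[n --> \oo] --> (0 : R).
Proof.
have -> : (0 : R) = (1 - 0) ^+ 3 * (1 - 4 / C * 0) - 1.
  by rewrite mulr0 !subr0 expr1n mulr1 subrr.
apply: cvgB; last exact: cvg_cst.
have h1 : (1 - n%:R^-1 : R) @[n --> \oo] --> (1 - 0 : R).
  by apply: cvgB; [exact: cvg_cst|exact: cvg_inv_natr].
apply: cvgM; first exact: (cvgM h1 (cvgM h1 h1)).
apply: cvgB; first exact: cvg_cst.
by apply: cvgM; [exact: cvg_cst|exact: cvg_ln_div].
Qed.

(** For radius [d ^ 3] an additive error [d] is a relative error of order [d ^ (-2)]: the base on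
    the right is [1 / (alpha + d ^ (-2))], at least [(1 - d ^ (-2)) / alpha], and Bernoulli's
    inequality bounds the power. Used with [alpha] equal to 1, 2 and [sqrt 3]. *)
Lemma shrink_pow_ge (d : nat) (alpha : R) : (1 < d)%N -> 1 <= alpha ->
  (1 - d%:R^-1) / alpha ^+ d <=
  (d%:R ^+ 3 / (alpha * d%:R ^+ 3 + d%:R)) ^+ d.
Proof.
move=> d1 a1; have d0 : 0 < d%:R :> R by rewrite ltr0n ltnW.
have a0 : 0 < alpha by exact: lt_le_trans a1.
pose t : R := d%:R^-1 ^+ 2.
have t0 : 0 < t by rewrite exprn_gt0// invr_gt0.
have t1 : t <= 1.
  by rewrite exprn_ile1 ?invr_ge0// invf_le1// ler1n ltnW.
apply: (@le_trans _ _ (((1 - t) / alpha) ^+ d)).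
  rewrite expr_div_n ler_pM2r ?invr_gt0 ?exprn_gt0//.
  have := @bernoulli_le _ t d; rewrite (ltW t0) t1 => /(_ isT);
    congr (1 - _ <= _).
  by rewrite /t; field; rewrite gt_eqF.
have den0 : 0 < alpha * d%:R ^+ 3 + d%:R.
  by rewrite addr_gt0// mulr_gt0// exprn_gt0.
rewrite lerXn2r ?nnegrE ?divr_ge0 ?subr_ge0 ?exprn_ge0 ?(ltW a0) ?(ltW den0)//.
rewrite (_ : d%:R ^+ 3 / _ = (alpha + t)^-1); last first.
  rewrite /t; field.
  rewrite !gt_eqF//= addr_gt0// mulr_gt0// exprn_gt0//.
rewrite ler_pdivrMr// ler_pdivlMl ?addr_gt0//; nra.
Qed.

Lemma density_lower_bound (d : nat) : (0 < d)%N ->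
  (((1 + density_error d) * (C * d%:R / 2 ^+ d))%:E <= packing_density R d)%E.
Proof.
move=> d_gt0; have d0 : 0 < d%:R :> R by rewrite ltr0n.
pose Y : R := C * d%:R - 4 * ln d%:R.
have -> : (1 + density_error d) * (C * d%:R / 2 ^+ d) =
    (1 - d%:R^-1) ^+ 3 * Y / 2 ^+ d.
  rewrite /density_error /Y [1 + _]addrC subrK.
  by field; rewrite !gt_eqF ?exprn_gt0.
have r_gt0 : 0 < d%:R ^+ 3 :> R by rewrite exprn_gt0.
have u0 : 0 <= 1 - d%:R^-1 :> R by rewrite subr_ge0 invf_le1// ler1n.
have theta0 : (0%:E <= packing_density R d)%E.
  have := @grid_packing_density R d 1 _ d_gt0 r_gt0 finset.set0.
  rewrite cards0 !mul0r; apply; apply/pairwise_farP => u v; by rewrite inE.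
(* The bound is trivial when [Y <= 0], and also for [d = 1], where [1 - 1/d] vanishes. *)
have [Y0|Y0] := leP Y 0.
  apply: le_trans theta0; rewrite lee_fin pmulr_lle0 ?invr_gt0 ?exprn_gt0//.
  by rewrite mulr_ge0_le0 ?exprn_ge0.
have [d1|] := ltnP 1 d; last first.
  move=> d_le1; have -> : d%:R = 1 :> R.
    by apply/eqP; rewrite pnatr_eq1 eqn_leq d_le1.
  by rewrite invr1 subrr expr0n/= !mul0r.
(* This makes [2 * r / M] equal to [d ^ (-2)], so the loss from the gaps is the case [alpha = 1] of
   [shrink_pow_ge]. *)
pose M := (2 * d ^ 5)%N; pose r : R := d%:R ^+ 3.
have M0 : (0 < M)%N by rewrite muln_gt0 expn_gt0 d_gt0.
pose v := ball_volume R d.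
have v0 : 0 < v by exact: ball_volume_gt0.
pose D : R := 2 * (v * (Num.sqrt 3 * r + d%:R) ^+ d).
have E0 : 0 < Num.sqrt 3 * r + d%:R by rewrite addr_gt0// mulr_gt0.
have D0 : 0 < D by rewrite mulr_gt0// mulr_gt0// exprn_gt0.
pose lam : R := (d%:R * D)^-1.
have lamD : lam * D = d%:R^-1 by rewrite /lam; field; rewrite !gt_eqF.
have lam0 : 0 < lam by rewrite invr_gt0 mulr_gt0.
have [|a aY] := @grid_density R d M r d_gt0 r_gt0 lam Y M0 lam0.
  by rewrite -/v -/D lamD invf_le1// ler1n.
rewrite -/v -/D lamD in aY * => theta; apply: le_trans theta; rewrite lee_fin.
have q_ge : (1 - d%:R^-1) * r ^+ d <= (M%:R * r / (M%:R + 2 * r)) ^+ d.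
  have := @shrink_pow_ge d 1 d1 (lexx _).
  rewrite expr1n divr1 mul1r -(ler_pM2r (exprn_gt0 d r_gt0)) -exprMn -/r.
  move/le_trans; apply; rewrite le_eqVlt; apply/orP; left; apply/eqP.
  congr (_ ^+ d); rewrite /M natrM natrX /r; field.
  by rewrite !lt0r_neq0 ?addr_gt0 ?mulr_gt0 ?exprn_gt0.
have rd0 : 0 < r ^+ d by rewrite exprn_gt0.
suff bound : (1 - d%:R^-1) ^+ 2 * Y / 2 ^+ d <= a * v * r ^+ d.
  have av0 : 0 <= a * v.
    rewrite -(pmulr_lge0 _ rd0) (le_trans _ bound)// divr_ge0 ?exprn_ge0//.
    by rewrite mulr_ge0 ?exprn_ge0 ?(ltW Y0).
  apply: le_trans (ler_wpM2l av0 q_ge).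
  rewrite mulrCA; apply: le_trans (ler_wpM2l u0 bound).
  by rewrite le_eqVlt; apply/orP; left; apply/eqP; ring.
have h2 := @shrink_pow_ge d 2 d1 (ler1n R 2).
have h3 := @shrink_pow_ge d (Num.sqrt 3) d1 sqrt3_ge1.
rewrite -/r !expr_div_n in h2 h3.
case: aY => aY.
  have Delta0 : 0 < (2 * r + d%:R) ^+ d by rewrite exprn_gt0// addr_gt0//
    mulr_gt0.
  rewrite (_ : _ / _ = ((1 - d%:R^-1) * Y) * ((1 - d%:R^-1) / 2 ^+ d));
    last by ring.
  apply: le_trans (ler_wpM2l _ h2) _; first by rewrite mulr_ge0// ltW.
  rewrite (_ : a * v * r ^+ d = a * (v * (2 * r + d%:R) ^+ d) *
    (r ^+ d / (2 * r + d%:R) ^+ d)); last by field; rewrite gt_eqF.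
  by rewrite ler_wpM2r// divr_ge0 ?ltW.
(* In this case the powers of [sqrt 3] cancel against [D]. Of the factor [d ^ 4], one [d] goes into
   [lam], and the remaining [d ^ 3 / 2] exceeds [Y], since [Y <= 2 * d] and [d >= 2]. *)
have expY : expR (- Y) = (Num.sqrt 3 / 2) ^+ d * d%:R ^+ 4.
  rewrite (_ : - Y = - C * d%:R + ln d%:R * 4%:R); last by rewrite /Y; ring.
  rewrite expRD !expRM_natr expRN !lnK ?posrE ?divr_gt0//.
  by rewrite invf_div.
apply: (@le_trans _ _ (lam * expR (- Y) * v * r ^+ d)); last first.
  by rewrite !ler_pM2r.
rewrite (_ : lam * expR (- Y) * v * r ^+ d = d%:R ^+ 3 / 2 *
    (Num.sqrt 3 / 2) ^+ d * (r ^+ d / (Num.sqrt 3 * r + d%:R) ^+ d));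
      last first.
  rewrite expY /lam /D; field.
  by rewrite !lt0r_neq0 ?exprn_gt0.
apply: le_trans (ler_wpM2l _ h3); last first.
  by rewrite mulr_ge0// ?exprn_ge0 ?divr_ge0 ?exprn_ge0// ltW.
rewrite [leRHS](_ : _ = (1 - d%:R^-1) * (d%:R ^+ 3 / 2) / 2 ^+ d); last first.
  by rewrite expr_div_n; field; rewrite !lt0r_neq0 ?exprn_gt0.
rewrite ler_pM2r ?invr_gt0 ?exprn_gt0// expr2 -mulrA ler_wpM2l//.
have ln0 : 0 <= ln d%:R :> R by rewrite ln_ge0// ler1n.
have d2 : 2 <= d%:R :> R by rewrite ler_nat.
apply: (@le_trans _ _ Y);
  first by rewrite ler_piMl ?(ltW Y0)// gerBl invr_ge0 ltW.
apply: (@le_trans _ _ (2 * d%:R)).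
  by have := ler_wpM2r (ltW d0) C_le2; rewrite /Y; lra.
rewrite (_ : d%:R ^+ 3 / 2 = d%:R ^+ 2 / 2 * d%:R); last by field.
by rewrite ler_pM2r//; nra.
Qed.

End asymptotics.

Theorem corollary3 (R : realType) :
  exists eps : nat -> R,
    eps n @[n --> \oo] --> (0 : R) /\
    forall d : nat, (0 < d)%N ->
      (((1 + eps d) * (ln (2 / Num.sqrt 3) * d%:R / 2 ^+ d))%:E
        <= packing_density R d)%E.
Proof.
exists (@density_error R); split; first exact: cvg_density_error.
by move=> d; exact: density_lower_bound.
Qed.
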